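(* If $T_0 \in \mathcal{G}(X)$ is periodic, then $\mathcal{S}_{T_0}$ is a first category subset of $\mathcal{G}_{T_0}$.
   Context: Let $(X,m)$ and $(Y,\nu)$ both be the unit interval with Lebesgue measure, and $(Z,\mu) = (X\times Y, m\times\nu)$. $\mathcal{G}(W)$ denotes the set of invertible measure-preserving transformations of a space $W$, with the weak topology ($T_n \to T$ iff $\mu(T_nE \triangle TE) \to 0$ for every measurable $E$). $T_0$ periodic means $T_0^p = \mathrm{id}_X$ (a.e.) for some integer $p \ge 1$. $\mathcal{G}_{T_0} \subset \mathcal{G}(Z)$ is the set of transformations of the form $T(x,y) = (T_0x, T_x y)$ with $T_x \in \mathcal{G}(Y)$ (extensions of $T_0$), with the relative weak topology; $T_0$ is identified with $T_0\times\mathrm{id}_Y$. $\mathbb{E}(\cdot|X)$ is conditional expectation onto the $\sigma$-algebra of sets $B\times Y$. $L^2(Z|X)$ is the space of $f\in L^2(Z)$ with $\mathbb{E}(|f|^2|X)^{1/2} \in L^\infty(X)$. $T\in\mathcal{G}_{T_0}$ is a strongly mixing extension of $T_0$ if for all $f,g\in L^2(Z|X)$, $\lim_{n\to\infty}\|\mathbb{E}(T^n f\cdot\overline{g}|X) - T_0^n\mathbb{E}(f|X)\mathbb{E}(\overline{g}|X)\|_{L^2(X)} = 0$, where $T^nf = f\circ T^n$; $\mathcal{S}_{T_0}$ is the set of such extensions. *)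

(* Defs.v *)
From HB Require Import structures.
From mathcomp Require Import all_boot all_order all_algebra.
From mathcomp Require Import all_classical all_reals all_analysis.
From mathcomp.real_closed Require Import complex.

Set Implicit Arguments.
Unset Strict Implicit.
Unset Printing Implicit Defensive.

Import Order.TTheory GRing.Theory Num.Theory.
Local Open Scope classical_set_scope.
Local Open Scope ring_scope.

Section Defs.
Context {R : realType}.

(** The unit interval [0,1] (as a set of reals). *)
Definition I01 : set R := `[0%R, 1%R].

Lemma measurable_I01 : measurable I01.
Proof. exact: measurable_itv. Qed.

(** (X, m) = (Y, nu) = ([0,1], Lebesgue measure), realised as Lebesgue measure
    on R restricted to [0,1]. *)
Definition mX : {measure set (measurableTypeR R) -> \bar R} :=
  mrestr (@lebesgue_measure R) measurable_I01.

(** (Z, mu) = (X x Y, m x nu), carried by the square [0,1] x [0,1]. *)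
Definition DZ : set (R * R) := I01 `*` I01.
Definition mZ : set (R * R) -> \bar R := (mX \x mX)%E.

(** G(W): invertible measure-preserving transformations of the space carried
    by D with measure mu (bimeasurable bijections of D preserving mu). *)
Definition inv_mpt {d} {T : measurableType d} (mu : set T -> \bar R)
    (D : set T) (f : T -> T) : Prop :=
  [/\ set_bij D D f,
      measurable_fun D f,
      (forall A, measurable A -> measurable (f @` (D `&` A))) &
      (forall A, measurable A -> mu (D `&` f @^-1` A) = mu A)].

(** T0 periodic: T0^p = id a.e. for some p >= 1. *)
Definition periodic_map (T0 : R -> R) : Prop :=
  exists p : nat, (1 <= p)%N /\ {ae mX, forall x, iter p T0 x = x}.

(** G_{T0}: extensions T(x,y) = (T0 x, T_x y) with T_x in G(Y), T in G(Z). *)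
Definition GT0 (T0 : R -> R) : set (R * R -> R * R) :=
  [set T | inv_mpt mZ DZ T /\
     exists Tf : R -> R -> R,
       (forall x, x \in I01 -> inv_mpt mX I01 (Tf x)) /\
       {ae mZ, forall z, T z = (T0 z.1, Tf z.1 z.2)}].

(** Weak topology (relative to a subset G of G(Z)):
    basic neighbourhoods N(T; E_0..E_{k-1}, eps)
      = {S | mu(S E_i Delta T E_i) < eps for all i < k}. *)
Definition symdiff {T} (A B : set T) : set T := (A `\` B) `|` (B `\` A).

Definition wnbhs (T : R * R -> R * R) (k : nat) (Es : nat -> set (R * R))
    (eps : R) : set (R * R -> R * R) :=
  [set S | forall i, (i < k)%N ->
     (mZ (symdiff (S @` (DZ `&` Es i)) (T @` (DZ `&` Es i))) < eps%:E)%E].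

Definition wopen (G U : set (R * R -> R * R)) : Prop :=
  U `<=` G /\
  forall T, U T -> exists k Es eps,
    [/\ (forall i, measurable (Es i)), 0 < eps & G `&` wnbhs T k Es eps `<=` U].

Definition nowhere_dense_in (G N : set (R * R -> R * R)) : Prop :=
  forall U, wopen G U -> U !=set0 ->
    exists V, [/\ wopen G V, V !=set0, V `<=` U & V `&` N = set0].

(** S is a first category subset of G: contained in a countable union of
    nowhere dense subsets of G. *)
Definition first_category_in (G S : set (R * R -> R * R)) : Prop :=
  S `<=` G /\
  exists N : nat -> set (R * R -> R * R),
    (forall n, nowhere_dense_in G (N n)) /\ S `<=` \bigcup_n N n.

(** Complex-valued functions: |z|^2 and integrals computed componentwise. *)
Definition csq (z : R[i]) : R := complex.Re z ^+ 2 + complex.Im z ^+ 2.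

Definition cintX (h : R -> R[i]) : R[i] :=
  (Rintegral mX I01 (fun y => complex.Re (h y)) +i*
   Rintegral mX I01 (fun y => complex.Im (h y)))%C.

(** E(f | X)(x) = integral over Y of f(x, .)  (conditional expectation onto
    the sigma-algebra of sets B x Y, for the product measure). *)
Definition condexpX (f : R * R -> R[i]) (x : R) : R[i] :=
  cintX (fun y => f (x, y)).

(** L^2(Z | X). *)
Definition L2ZX (f : R * R -> R[i]) : Prop :=
  [/\ measurable_fun DZ (fun z => complex.Re (f z)),
      measurable_fun DZ (fun z => complex.Im (f z)),
      (\int[mZ]_(z in DZ) (csq (f z))%:E < +oo)%E &
      exists C : R, {ae mX, forall x,
        (\int[mX]_(y in I01) (csq (f (x, y)))%:E <= C%:E)%E}].

(** Strongly mixing extension. *)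
Definition strongly_mixing_ext (T0 : R -> R) (T : R * R -> R * R) : Prop :=
  forall f g : R * R -> R[i], L2ZX f -> L2ZX g ->
    (fun n : nat => \int[mX]_(x in I01)
       (csq (condexpX (fun z => f (iter n T z) * (g z)^*) x
             - condexpX f (iter n T0 x) * condexpX (fun z => (g z)^*) x))%:E)%E
    @ \oo --> 0%E.

Definition ST0 (T0 : R -> R) : set (R * R -> R * R) :=
  [set T | GT0 T0 T /\ strongly_mixing_ext T0 T].

End Defs.

(* Main.v *)
(** Let [E] be the lower half of the square. Mixing with [f = g = 1_E] forces
    [mu (S^k E /\ E)] to tend to [1/4], so [mu (S^k E \symdiff E)] is bounded below
    for all large [k]; the set of extensions for which it is at least [1/8] for
    every [k >= n] is nowhere dense, because periodic extensions (for which it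
    vanishes along a subsequence) are weakly dense.

    Density of periodic extensions: over a [T0]-periodic base, let [W] be the set
    of points lying above the leftmost element of their [T0]-orbit. A greedy
    construction gives [B] inside [W], met by every orbit in bounded time, whose
    returns take time at least [M] (except for points of period below [M]).
    Sending the top of each [T]-column over [B] back to its base instead of to the
    next column gives a map with columns of bounded height as cycles. It is still
    an extension of [T0], since return times to [W] are periods of [T0], and it
    differs from [T] on a set of measure at most [1/M]. *)

Require Import Defs.
From HB Require Import structures.
From mathcomp Require Import all_boot all_order all_algebra.
From mathcomp Require Import all_classical all_reals all_analysis.
From mathcomp.real_closed Require Import complex.
From mathcomp Require Import zify lra measurable_realfun.

Set Implicit Arguments.
Unset Strict Implicit.
Unset Printing Implicit Defensive.

Import Order.TTheory GRing.Theory Num.Theory.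
Local Open Scope classical_set_scope.
Local Open Scope ring_scope.

(** * Markers *)

Lemma iter_can (Z : Type) (F Fi : Z -> Z) n :
  cancel F Fi -> cancel (iter n F) (iter n Fi).
Proof. by move=> FK; elim: n => // n IH z; rewrite iterSr iterS FK IH. Qed.

Lemma iter_can_leq (Z : Type) (F Fi : Z -> Z) m n z :
  cancel F Fi -> (m <= n)%N -> iter m Fi (iter n F z) = iter (n - m) F z.
Proof. by move=> FK mn; rewrite -{1}(subnKC mn) iterD iter_can. Qed.

Lemma measurable_iter d (Z : measurableType d) (F : Z -> Z) n :
  measurable_fun setT F -> measurable_fun setT (iter n F).
Proof.
by move=> mF; elim: n => [|n IH]; [exact: measurable_id|exact: measurableT_comp].
Qed.

Lemma measurable_preimage d d' (Z : measurableType d) (Z' : measurableType d')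
    (F : Z -> Z') A :
  measurable_fun setT F -> measurable A -> measurable (F @^-1` A).
Proof. by move=> mF mA; rewrite -[X in measurable X]setTI; exact: mF. Qed.

Section marker.
Context d (Z : measurableType d).
Variables (F Fi : Z -> Z) (V : nat -> set Z) (W : set Z) (M : nat).
Hypotheses (FK : cancel F Fi) (FiK : cancel Fi F).
Hypotheses (mF : measurable_fun setT F) (mFi : measurable_fun setT Fi).
Hypotheses (mV : forall n, measurable (V n)) (mW : measurable W).
(** The countable family [V] is the device for measurable choice: it makes fixed points measurable
    and lets the greedy construction treat [V 0], [V 1], ... one at a time. *)
Hypothesis sepV : forall (z : Z) (k : nat) (w : nat -> Z),
  exists n, V n z /\ forall i, (i < k)%N -> w i <> z -> ~ V n (w i).

(** Candidates of stage [n]: two of them on one orbit, fewer than [M] steps apart, must coincide, so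
    a whole stage can be accepted at once. *)
Let U n := [set z | [/\ W z, V n z & forall i, (i < M)%N ->
  V n (iter i F z) -> iter i F z = z]].

Let near_orbit (A : set Z) := [set z | exists i, (i < M)%N /\
  (A (iter i F z) \/ A (iter i Fi z))].

Fixpoint marker_step n : set Z := if n is m.+1 then
  marker_step m `|` (U m `\` near_orbit (marker_step m)) else set0.

Let A := \bigcup_n marker_step n.

(** Since the sets [V n] separate points, [iter i F z = z] holds iff each [V n] contains both points
    or neither, which is a countable condition. *)
Lemma measurable_fixpoints i : measurable [set z | iter i F z = z].
Proof.
have -> : [set z | iter i F z = z] =
    \bigcap_n (V n `&` iter i F @^-1` V n `|` ~` V n `&` iter i F @^-1` (~` V n)).
  apply/seteqP; split => [z /= zE n _|z /= zn].
    by rewrite /= zE; have [|] := pselect (V n z); [left|right].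
  apply: contrapT => zE.
  have [n [Vz Vi]] := @sepV z 1%N (fun=> iter i F z).
  have [[_ Vi']|[+ _]] := zn n I; last exact.
  exact: (Vi 0%N).
apply: bigcapT_measurable => n; apply: measurableU; apply: measurableI => //.
- by apply: measurable_preimage => //; exact: measurable_iter.
- exact: measurableC.
- by apply: measurable_preimage; [exact: measurable_iter|exact: measurableC].
Qed.

Let mU n : measurable (U n).
Proof.
have -> : U n = W `&` V n `&` \bigcap_(i in [set i | (i < M)%N])
    (~` (iter i F @^-1` V n) `|` [set z | iter i F z = z]).
  apply/seteqP; split => [z [Wz Vz Uz]|z [[Wz Vz] Uz]].
    split => // i /= /Uz; case: (pselect (V n (iter i F z))); last by left.
    by move=> Vi h; right; exact: h.
  by split => // i iM Vi; case: (Uz i iM).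
apply: measurableI; first exact: measurableI.
apply: bigcap_measurableType => i _; apply: measurableU; last exact: measurable_fixpoints.
by apply/measurableC/measurable_preimage => //; exact: measurable_iter.
Qed.

Let near_orbitE B : near_orbit B =
  \bigcup_(i in [set i | (i < M)%N]) (iter i F @^-1` B `|` iter i Fi @^-1` B).
Proof.
by apply/seteqP; split => [z [i [iM zB]]|z [i iM zB]]; exists i.
Qed.

Lemma measurable_marker_step n : measurable (marker_step n).
Proof.
elim: n => [|n IH]; first exact: measurable0.
apply: measurableU => //; apply: measurableD; first exact: mU.
rewrite near_orbitE; apply: bigcup_measurable => i _.
by apply: measurableU; apply: measurable_preimage => //; exact: measurable_iter.
Qed.

Let marker_step_homo : {homo marker_step : m n / (m <= n)%N >-> m `<=` n}.
Proof.
apply: homo_leq => [B|B C D|n]; [exact: subset_refl|exact: subset_trans|].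
exact: subsetUl.
Qed.

(** If one of the two points was accepted strictly earlier, [near_orbit] would have excluded the
    other; if both enter at the same stage, the definition of [U] makes them equal. *)
Let marker_step_return n z i : (0 < i < M)%N ->
  marker_step n z -> marker_step n (iter i F z) -> iter i F z = z.
Proof.
move=> /andP[i0 iM]; elim: n => [//|n IH] [zn|[[Wz Vz Uz] zn]] [in_|[[Wi Vi Ui] in_]].
- exact: IH.
- by exfalso; apply: in_; exists i; split => //; right; rewrite iter_can.
- by exfalso; apply: zn; exists i; split => //; left.
- exact: Uz.
Qed.

(* Greedy construction: a point of [W] is refused by [marker_step] only when some
   point of its orbit at distance less than [M] has been accepted before. *)
Lemma marker_set : (0 < M)%N -> exists B, [/\ measurable B, B `<=` W,
  (forall z i, (0 < i < M)%N -> B z -> B (iter i F z) -> iter i F z = z) &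
  (forall z, W z -> exists i, (i < M)%N /\ (B (iter i F z) \/ B (iter i Fi z)))].
Proof.
move=> M0; exists A; split.
- exact: bigcupT_measurable measurable_marker_step.
- move=> z [n _]; elim: n => [//|n IH] [/IH //|[[]]] //.
- move=> z i iM [m _ zm] [n _ zn].
  by apply: (@marker_step_return (maxn m n)) => //;
    [exact: marker_step_homo (leq_maxl _ _) _ zm
    |exact: marker_step_homo (leq_maxr _ _) _ zn].
- move=> z Wz.
  have [n [Vz Vw]] := sepV z M (fun i => iter i F z).
  have Uz : U n z.
    by split => // i iM Vi; apply: contrapT => iz; exact: (Vw i iM).
  have [[i [iM ni]]|nz] := pselect (near_orbit (marker_step n) z).
    by exists i; split => //; case: ni => ni; [left|right]; exists n.
  by exists 0%N; split => //; left; exists n.+1 => //; right.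
Qed.

End marker.

(** * Induced maps *)

Definition first_return (Z : Type) (F : Z -> Z) (A : set Z) (z : Z) (h : nat) :=
  [/\ A z, (0 < h)%N, A (iter h F z) &
      forall i, (0 < i < h)%N -> ~ A (iter i F z)].

(* Equal to [0] outside [A] and at points of [A] that never return. *)
Definition return_time (Z : Type) (F : Z -> Z) (A : set Z) (z : Z) : nat :=
  xget 0%N [set h | first_return F A z h].

(* Since [return_time] vanishes off [A], this is the identity there. *)
Definition induced (Z : Type) (F : Z -> Z) (A : set Z) (z : Z) : Z :=
  iter (return_time F A z) F z.

Definition recurrent (Z : Type) (F : Z -> Z) (A : set Z) :=
  forall z, A z -> exists h, (0 < h)%N /\ A (iter h F z).

Section induced_map.
Variables (Z : Type) (A : set Z).
Implicit Types F Fi : Z -> Z.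

Lemma first_return_uniq F z h k :
  first_return F A z h -> first_return F A z k -> h = k.
Proof.
move=> [_ h0 Ah nh] [_ k0 Ak nk].
have [hk|kh|//] := ltngtP h k; first by case: (nk h); rewrite ?h0.
by case: (nh k); rewrite ?k0.
Qed.

(** An excursion from [A] back to [A], read backwards, is a first-return excursion of the inverse
    map with the same length. *)
Lemma first_return_sym F Fi z h : cancel F Fi ->
  first_return F A z h -> first_return Fi A (iter h F z) h.
Proof.
move=> FK [Az h0 Ah nh]; split => //; first by rewrite iter_can.
move=> i /andP[i0 ih]; rewrite iter_can_leq ?(ltnW ih)//; apply: nh.
by rewrite subn_gt0 ltn_subrL i0 ih (leq_trans _ ih).
Qed.

Lemma return_timeP F z h : first_return F A z h -> return_time F A z = h.
Proof.
move=> zh; rewrite /return_time; case: xgetP => [k _ zk|/(_ h)//].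
exact: first_return_uniq zk zh.
Qed.

Lemma return_time_notin F z : ~ A z -> return_time F A z = 0%N.
Proof. by move=> nAz; rewrite /return_time; case: xgetP => // h _ []. Qed.

Lemma induced_notin F z : ~ A z -> induced F A z = z.
Proof. by move=> nAz; rewrite /induced return_time_notin. Qed.

Lemma recurrent_first_return F z : recurrent F A -> A z ->
  first_return F A z (return_time F A z).
Proof.
move=> rF Az; rewrite /return_time; case: xgetP => // nz; exfalso.
have ex : exists h, `[< (0 < h)%N /\ A (iter h F z) >].
  by have [h hA] := rF _ Az; exists h; apply/asboolP.
case: (ex_minnP ex) => h /asboolP[h0 Ah] hmin; apply: (nz h); split => //.
move=> i /andP[i0 ih] Ai.
have /hmin : `[< (0 < i)%N /\ A (iter i F z) >] by exact/asboolP.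
by rewrite leqNgt ih.
Qed.

Lemma return_time_induced F Fi z : cancel F Fi -> recurrent F A ->
  return_time Fi A (induced F A z) = return_time F A z.
Proof.
move=> FK rF; have [Az|nAz] := pselect (A z); last first.
  by rewrite induced_notin// !return_time_notin.
exact/return_timeP/first_return_sym/recurrent_first_return.
Qed.

Lemma induced_can F Fi : cancel F Fi -> recurrent F A ->
  cancel (induced F A) (induced Fi A).
Proof.
by move=> FK rF z; rewrite {1}/induced return_time_induced// iter_can.
Qed.

End induced_map.

Lemma measurable_return_time d (Z : measurableType d) (F : Z -> Z) (A : set Z) n :
  measurable_fun setT F -> measurable A ->
  measurable [set z | return_time F A z = n].
Proof.
move=> mF mA.
have mR h : measurable [set z | first_return F A z h].
  have [->|h0] := posnP h.
    rewrite (_ : [set _ | _] = set0)//.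
    by apply/seteqP; split => // z [].
  rewrite (_ : [set _ | _] = A `&` iter h F @^-1` A `&`
      \bigcap_(i in [set i | (0 < i < h)%N]) (~` (iter i F @^-1` A))); last first.
    by apply/seteqP; split => [z [Az _ Ah nh]|z [[Az Ah] nA]]; do ?split.
  apply: measurableI; first apply: measurableI => //.
    by apply: measurable_preimage => //; exact: measurable_iter.
  apply: bigcap_measurableType => i _; apply: measurableC.
  by apply: measurable_preimage => //; exact: measurable_iter.
(* A first-return time is positive, so the default value 0 marks exactly the points without one: its
   level set is the complement of all the others. *)
have [->|n0] := posnP n.
  rewrite (_ : [set _ | _] = ~` \bigcup_h [set z | first_return F A z h]).
    exact/measurableC/bigcupT_measurable.
  apply/seteqP; split => [z /= z0 [h _ zh]|z /= nz].
    by case: (zh); rewrite -(return_timeP zh) z0.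
  by rewrite /return_time; case: xgetP => // h _ zh; case: nz; exists h.
rewrite (_ : [set _ | _] = [set z | first_return F A z n])//.
apply/seteqP; split => z /=; last by move=> zn; exact: return_timeP.
by rewrite /return_time; case: xgetP => [h _ zh <-//|_ n0']; rewrite -n0' in n0.
Qed.

Section induced_measure.
Context d (Z : measurableType d) (R : realType) (mu : {measure set Z -> \bar R}).
Variables (F Fi : Z -> Z) (A : set Z).
Hypotheses (FK : cancel F Fi) (FiK : cancel Fi F).
Hypotheses (mF : measurable_fun setT F) (mFi : measurable_fun setT Fi).
Hypotheses (mA : measurable A) (rF : recurrent F A) (rFi : recurrent Fi A).

(** Cutting the target by the backward return time makes each piece of the preimage a full preimage
    under a single iterate of [F], whose measure is known. *)
Lemma preimage_induced B : induced F A @^-1` B =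
  \bigcup_n (iter n F @^-1` ([set z | return_time Fi A z = n] `&` B)).
Proof.
apply/seteqP; split => [z zB|z [n _ [/= zn zB]]].
  by exists (return_time F A z) => //; split => //=; exact: return_time_induced.
suff -> : induced F A z = iter n F z by [].
have := return_time_induced (iter n F z) FiK rFi.
by rewrite /induced zn iter_can// => ->.
Qed.

Lemma measurable_induced : measurable_fun setT (induced F A).
Proof.
move=> _ B mB; rewrite setTI preimage_induced; apply: bigcupT_measurable => n.
apply: measurable_preimage; first exact: measurable_iter.
by apply: measurableI => //; exact: measurable_return_time.
Qed.

Hypothesis muF : forall B, measurable B -> mu (F @^-1` B) = mu B.

Lemma measure_preimage_iter n B : measurable B -> mu (iter n F @^-1` B) = mu B.
Proof.
move=> mB; elim: n => [//|n IH].
rewrite -IH -[RHS]muF; last by apply: measurable_preimage => //; exact: measurable_iter.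
by congr (mu _); apply/seteqP; split => z; rewrite /preimage/= -iterSr.
Qed.

Lemma measure_preimage_induced B : measurable B -> mu (induced F A @^-1` B) = mu B.
Proof.
move=> mB; pose Q n := [set z | return_time Fi A z = n] `&` B.
have mQ n : measurable (Q n) by apply: measurableI => //; exact: measurable_return_time.
rewrite preimage_induced; have {2}-> : B = \bigcup_n Q n.
  by apply/seteqP; split => [z zB|z [n _ []]//]; exists (return_time Fi A z).
rewrite !measure_bigcup//.
- by apply: eq_eseriesr => n _; exact: (measure_preimage_iter n (mQ n)).
- by move=> m n _ _ [z [[/= <- _] [/= <- _]]].
- by move=> n _; apply: measurable_preimage; [exact: measurable_iter|exact: mQ].
(* The pulled-back pieces are disjoint because the index of a piece is the forward return time of
   each of its points. *)
- move=> m n _ _ [z [[/= zm _] [/= zn _]]].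
  suff H k : return_time Fi A (iter k F z) = k -> return_time F A z = k.
    by rewrite -(H _ zm) -(H _ zn).
  move=> zk; rewrite -[RHS]zk -(return_time_induced (iter k F z) FiK rFi).
  by rewrite /induced zk iter_can.
Qed.

End induced_measure.

(** * Measure-preserving isomorphisms *)

(** Unlike [inv_mpt], this concerns the whole space and names the inverse, so that images are
    preimages under [Fi] and iterates raise no domain conditions. *)
Definition mp_iso d (Z : measurableType d) (R : realType) (mu : set Z -> \bar R)
    (F Fi : Z -> Z) :=
  [/\ cancel F Fi, cancel Fi F, measurable_fun setT F, measurable_fun setT Fi &
      forall B, measurable B -> mu (F @^-1` B) = mu B].

Lemma image_can (T U : Type) (F : T -> U) (Fi : U -> T) (A : set T) :
  cancel F Fi -> cancel Fi F -> F @` A = Fi @^-1` A.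
Proof.
move=> FK FiK; apply/seteqP; split => [_ [z Az <-]|z Az]; first by rewrite /preimage/= FK.
by exists (Fi z).
Qed.

Section mp_iso.
Context d (Z : measurableType d) (R : realType) (mu : {measure set Z -> \bar R}).
Implicit Types F Fi : Z -> Z.

Lemma mp_iso_sym F Fi : mp_iso mu F Fi -> mp_iso mu Fi F.
Proof.
move=> [FK FiK mF mFi muF]; split => // B mB.
rewrite -[LHS]muF; last exact: measurable_preimage.
by congr (mu _); apply/seteqP; split => z; rewrite /preimage/= FK.
Qed.

Lemma mp_iso_comp F Fi G Gi : mp_iso mu F Fi -> mp_iso mu G Gi ->
  mp_iso mu (F \o G) (Gi \o Fi).
Proof.
move=> [FK FiK mF mFi muF] [GK GiK mG mGi muG]; split.
- exact: can_comp.
- exact: can_comp.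
- exact: measurableT_comp.
- exact: measurableT_comp.
move=> B mB; rewrite comp_preimage muG; first exact: muF.
exact: measurable_preimage.
Qed.

Lemma mp_iso_iter F Fi n : mp_iso mu F Fi -> mp_iso mu (iter n F) (iter n Fi).
Proof.
move=> [FK FiK mF mFi muF]; split; try exact: iter_can; try exact: measurable_iter.
exact: measure_preimage_iter.
Qed.

Lemma measurable_image_iso F Fi A : mp_iso mu F Fi -> measurable A ->
  measurable (F @` A).
Proof.
by move=> [FK FiK mF mFi _] mA; rewrite (image_can _ FK FiK); exact: measurable_preimage.
Qed.

Lemma measure_image_iso F Fi A : mp_iso mu F Fi -> measurable A ->
  mu (F @` A) = mu A.
Proof.
move=> iF mA; have [_ _ _ _ muFi] := mp_iso_sym iF.
by have [FK FiK _ _ _] := iF; rewrite (image_can _ FK FiK) muFi.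
Qed.

Variables (D : set Z) (mD : measurable D) (D0 : mu (~` D) = 0%E).

Let mu_setID A : measurable A -> mu (D `&` A) = mu A.
Proof.
move=> mA; rewrite [RHS](measureDI mu mA mD) setIC.
rewrite [X in (X + _)%E](_ : _ = 0%E) ?add0e//.
by apply: (subset_measure0 _ (measurableC mD)) => //; exact: measurableD.
Qed.

(** Extend [f] by the identity off the conull set [D]. The inverse is picked by choice on [D]; it is
    measurable because [f] maps measurable subsets of [D] to measurable sets. *)
Lemma inv_mpt_mp_iso f : inv_mpt mu D f ->
  exists F Fi, [/\ mp_iso mu F Fi, (forall z, D z -> F z = f z),
    (forall z, D z -> D (F z)) & (forall z, ~ D z -> F z = z)].
Proof.
move=> [[fD finj fsurj] mf mfi muf].
pose F z := if z \in D then f z else z.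
pose Fi z := if z \in D then xget z [set w | D w /\ f w = z] else z.
have FE z : D z -> F z = f z by move=> Dz; rewrite /F mem_set.
have FN z : ~ D z -> F z = z by move=> Dz; rewrite /F memNset.
have FD z : D z -> D (F z) by move=> Dz; rewrite FE//; exact: fD.
have FiN z : ~ D z -> Fi z = z by move=> Dz; rewrite /Fi memNset.
have FiD z : D z -> D (Fi z) /\ f (Fi z) = z.
  move=> Dz; rewrite /Fi mem_set//; case: xgetP => [w _ []//|nw].
  by have [w Dw wz] := fsurj _ Dz; case: (nw w).
have FK : cancel F Fi.
  move=> z; have [Dz|nDz] := pselect (D z); last by rewrite FN// FiN.
  have [DFi fFi] := FiD _ (FD _ Dz).
  by apply: finj; rewrite ?inE// fFi FE.
have FiK : cancel Fi F.
  move=> z; have [Dz|nDz] := pselect (D z); last by rewrite FiN// FN.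
  by have [DFi fFi] := FiD _ Dz; rewrite FE.
have preF B : F @^-1` B = (D `&` f @^-1` B) `|` (B `\` D).
  apply/seteqP; split => z; rewrite /preimage /=.
    have [Dz|nDz] := pselect (D z); first by rewrite FE//; left.
    by rewrite FN//; right.
  by move=> [[Dz]|[Bz nDz]]; [rewrite FE|rewrite FN].
have preFi B : Fi @^-1` B = f @` (D `&` B) `|` (B `\` D).
  rewrite -(image_can _ FK FiK); apply/seteqP; split => [_ [z Bz <-]|z].
    have [Dz|nDz] := pselect (D z); first by left; exists z => //; rewrite FE.
    by right; rewrite FN.
  by move=> [[w [Dw Bw] <-]|[Bz nDz]]; [exists w => //; exact: FE|exists z => //; exact: FN].
exists F, Fi; split => //; split => //.
- move=> _ B mB; rewrite setTI preF.
  by apply: measurableU; [exact: mf|apply: measurableD].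
- move=> _ B mB; rewrite setTI preFi.
  by apply: measurableU; [exact: mfi|apply: measurableD].
move=> B mB; rewrite preF -mu_setID; last first.
  by apply: measurableU; [exact: mf|apply: measurableD].
rewrite setIUr setDE setICA setICr setI0 setU0 setIA setIid; exact: muf.
Qed.

Lemma mp_iso_inv_mpt F Fi : mp_iso mu F Fi -> (forall z, D z <-> D (F z)) ->
  inv_mpt mu D F.
Proof.
move=> iF DF; have [FK FiK mF mFi muF] := iF; split.
- split => [z /DF//|z w _ _ /(can_inj FK)//|z Dz].
  by exists (Fi z) => //; apply/DF; rewrite FiK.
- exact: measurable_funS mF.
- by move=> A mA; apply: (measurable_image_iso iF); exact: measurableI.
- by move=> A mA; rewrite mu_setID ?muF//; exact: measurable_preimage.
Qed.

Lemma inv_mpt_comp f g : inv_mpt mu D f -> inv_mpt mu D g -> inv_mpt mu D (f \o g).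
Proof.
move=> [[fD fi fs] mf imf muf] [[gD gi gs] mg img mug].
have gfE A : D `&` (f \o g) @^-1` A = D `&` g @^-1` (D `&` f @^-1` A).
  by apply/seteqP; split => [z [Dz fg]|z [Dz [_ fg]]]; do ?split => //; exact: gD.
split.
- split.
  + by move=> z /gD /fD.
  + move=> z w zD wD /= /fi fgi; apply: gi => //.
    by apply: fgi; rewrite inE; apply: gD; exact/set_mem.
  + move=> z /fs[w /gs[v Dv <-] <-]; by exists v.
- by move=> _ A mA; rewrite gfE; apply: mg => //; exact: mf.
- move=> A mA; rewrite [X in measurable X](_ : _ = f @` (D `&` g @` (D `&` A))).
    by apply: imf; exact: img.
  apply/seteqP; split => [_ [z [Dz Az] <-]|_ [w [Dw [z [Dz Az] gz]] <-]].
    by exists (g z) => //; split; [exact: gD|exists z].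
  by exists z => //=; rewrite gz.
- by move=> A mA; rewrite gfE mug ?muf//; exact: mf.
Qed.

End mp_iso.

(** * Periodic approximation *)

Section columns.
Variables (Z : Type) (F Fi : Z -> Z) (G W B : set Z) (p M : nat).
Hypotheses (FK : cancel F Fi) (FiK : cancel Fi F).
Hypotheses (WG : W `<=` G) (GF : forall z, G z -> G (F z))
  (GFi : forall z, G z -> G (Fi z)).
Hypothesis GW : forall z, G z -> exists i, (i < p)%N /\ W (iter i F z).
Hypotheses (M_gt0 : (0 < M)%N) (BW : B `<=` W).
Hypothesis Bhit : forall z, W z ->
  exists i, (i < M)%N /\ (B (iter i F z) \/ B (iter i Fi z)).

Let G_iter (f : Z -> Z) n z : (forall w, G w -> G (f w)) -> G z -> G (iter n f z).
Proof. by move=> fG Gz; elim: n => //= n; exact: fG. Qed.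

(** Moving [M] steps before looking for [W] ensures that a marker found fewer than [M] steps behind
    that visit is still strictly ahead of [z]. *)
Let forward_hit z : G z -> exists k, (0 < k <= M + p + M)%N /\ B (iter k F z).
Proof.
move=> Gz; have [i [ip Wi]] := GW (G_iter M GF Gz).
have [j [jM [|]]] := Bhit Wi; rewrite -iterD.
  by rewrite -iterD => Bj; exists (j + (i + M))%N; split; [lia|rewrite addnA].
rewrite iter_can_leq//; last by lia.
by move=> Bj; exists (i + M - j)%N; split => //; lia.
Qed.

(** Going back [M + p] steps and then fewer than [p] forward reaches [W] more than [M] steps before
    [z], so a marker on either side of it is strictly behind [z]. *)
Let backward_hit z : G z -> exists k, (0 < k)%N /\ B (iter k Fi z).
Proof.
move=> Gz; have [i [ip]] := GW (G_iter (M + p) GFi Gz).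
rewrite iter_can_leq//; last by lia.
move=> Wi; have [j [jM [|]]] := Bhit Wi.
  rewrite iter_can_leq//; last by lia.
  by exists (M + p - i - j)%N; split => //; lia.
by rewrite -iterD => Bj; exists (j + (M + p - i))%N; split => //; lia.
Qed.

Lemma recurrent_marker : recurrent F B.
Proof.
move=> z /BW /WG /forward_hit[k [/andP[k0 _] Bk]]; by exists k.
Qed.

Lemma recurrent_marker_inv : recurrent Fi B.
Proof. by move=> z /BW /WG /backward_hit. Qed.

(** [F] sends the top of a column to the base of the next one; [phi], the backward first return to
    [B], brings it down to the base of its own column and fixes every point off [B]. Hence [S]
    rotates each column. *)
Let phi := induced Fi B.
Let S := phi \o F.

Let S_before_return a h j : first_return F B a h -> (j < h)%N ->
  iter j S a = iter j F a.
Proof.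
move=> [_ _ _ nh]; elim: j => [//|j IH] jh.
rewrite iterS IH ?(ltnW jh)// /S /= /phi induced_notin//.
by rewrite -iterS; apply: nh; rewrite jh.
Qed.

Let S_return a h : first_return F B a h -> iter h S a = a.
Proof.
move=> ah; have [Ba h0 Bh _] := ah.
rewrite -(prednK h0) iterS (S_before_return ah) ?prednK// /S /=.
rewrite -iterS prednK// -(return_timeP ah).
by rewrite -/(induced F B a) /phi (induced_can FK recurrent_marker).
Qed.

(** The column of [z] stands over [a], the latest visit to [B] at or before [z]. Its height is at
    most [M + p + M], so the factorial is a common multiple of all heights. *)
Lemma periodic_induced z : G z -> iter (M + p + M)`! S z = z.
Proof.
move=> Gz.
have ex : exists i, `[< B (iter i Fi z) >].
  by have [k [_ Bk]] := backward_hit Gz; exists k; exact/asboolP.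
case: (ex_minnP ex) => i /asboolP Ba imin.
set a := iter i Fi z in Ba.
have zE : iter i F a = z by rewrite /a iter_can.
have ah := recurrent_first_return recurrent_marker Ba.
set h := return_time F B a in ah; have [_ h0 Bh nh] := ah.
have ih : (i < h)%N.
  rewrite ltnNge; apply/negP => hi; move: Bh; rewrite /a iter_can_leq// => Bh.
  have /imin : `[< B (iter (i - h) Fi z) >] by exact/asboolP.
  by lia.
have hH : (h <= M + p + M)%N.
  have [k [/andP[k0 kH] Bk]] := forward_hit (WG (BW Ba)).
  rewrite (leq_trans _ kH)// leqNgt; apply/negP => kh.
  by apply: (nh k) => //; rewrite k0.
have hz : iter h S z = z.
  rewrite -zE -(S_before_return ah ih) -iterD addnC iterD.
  by rewrite (S_return ah).
have /dvdnP[m ->] : (h %| (M + p + M)`!)%N by apply: dvdn_fact; rewrite h0.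
by elim: m => // m IH; rewrite mulSn iterD IH.
Qed.

End columns.

Lemma induced_displaced (Z : Type) (Fi : Z -> Z) (B : set Z) (z : Z) :
  recurrent Fi B -> induced Fi B z <> z ->
  B z /\ exists h, induced Fi B z = iter h Fi z /\ B (induced Fi B z).
Proof.
move=> rFi; have [Bz|nBz] := pselect (B z); last by rewrite induced_notin.
move=> _; split => //; exists (return_time Fi B z); split => //.
by have [] := recurrent_first_return rFi Bz.
Qed.

(** * Measure of the set moved by the return map *)

Section displacement.
Context d (Z : measurableType d) (R : realType) (mu : {measure set Z -> \bar R}).
Variables (F Fi : Z -> Z) (V : nat -> set Z) (B : set Z) (M : nat).
Hypothesis iF : mp_iso mu F Fi.
Hypotheses (mV : forall n, measurable (V n)) (mB : measurable B).
Hypothesis sepV : forall (z : Z) (k : nat) (w : nat -> Z),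
  exists n, V n z /\ forall i, (i < k)%N -> w i <> z -> ~ V n (w i).
Hypotheses (rF : recurrent F B) (rFi : recurrent Fi B).
Hypothesis Bdiscrete : forall z i, (0 < i < M)%N ->
  B z -> B (iter i F z) -> iter i F z = z.

Let FK : cancel F Fi. Proof. by case: iF. Qed.
Let FiK : cancel Fi F. Proof. by case: iF. Qed.
Let mF : measurable_fun setT F. Proof. by case: iF. Qed.
Let mFi : measurable_fun setT Fi. Proof. by case: iF. Qed.

Let phi := induced Fi B.
Let D := [set z | phi z <> z].

Let mphi : measurable_fun setT phi := measurable_induced FiK FK mFi mF mB rFi rF.

Lemma measurable_displaced : measurable D.
Proof.
have -> : D = \bigcup_n (V n `&` phi @^-1` (~` V n)).
  apply/seteqP; split => [z zD|z [n _ [Vz nVz]] zE].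
    have [n [Vz nV]] := @sepV z 1%N (fun=> phi z).
    by exists n => //; split => //; exact: (nV 0%N).
  by apply: nVz; rewrite zE.
apply: bigcupT_measurable => n; apply: measurableI => //.
by apply: measurable_preimage => //; exact: measurableC.
Qed.

(** Displaced points lie in [B], so two of them fewer than [M] steps apart coincide. Then [z] has a
    period below [M], its backward return to [B] takes fewer than [M] steps, and [Bdiscrete] makes
    that return equal to [z]: it was not displaced. *)
Let displaced_discrete z i : (0 < i < M)%N -> D z -> ~ D (iter i F z).
Proof.
move=> /andP[i0 iM] Dz Di; have [Bz _] := induced_displaced rFi Dz.
have [Bi _] := induced_displaced rFi Di.
have iz : iter i F z = z by apply: Bdiscrete => //; rewrite i0.
have zi : iter i Fi z = z by rewrite -[in LHS]iz iter_can.
have zh := recurrent_first_return rFi Bz.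
apply: Dz; rewrite /phi /induced.
set h := return_time Fi B z in zh *; have [_ h0 Bh nh] := zh.
have hi : (h <= i)%N.
  rewrite leqNgt; apply/negP => ih; apply: (nh i); first by rewrite i0.
  by rewrite zi.
have Ez : iter h F (iter h Fi z) = z by rewrite iter_can.
by rewrite -[RHS]Ez (Bdiscrete _ Bh) ?Ez// h0 (leq_ltn_trans hi).
Qed.

(** The preimages of [D] under the first [M] iterates are disjoint and all have the measure of
    [D]. *)
Lemma measure_displaced : (M%:R%:E * mu D <= mu setT)%E.
Proof.
have mDi (i : 'I_M) : measurable (iter i F @^-1` D).
  apply: measurable_preimage; first exact: measurable_iter.
  exact: measurable_displaced.
have tD : trivIset setT (fun i : 'I_M => iter i F @^-1` D).
  have lt_absurd (i j : 'I_M) z : (i < j)%N -> D (iter i F z) -> ~ D (iter j F z).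
    move=> ij Di; rewrite -(subnK (ltnW ij)) iterD; apply: displaced_discrete => //.
    by rewrite subn_gt0 ij (leq_ltn_trans (leq_subr _ _)).
  move=> i j _ _ [z [/= Di Dj]]; apply: val_inj => /=.
  have [ij|ji|//] := ltngtP i j.
    by case: (lt_absurd _ _ _ ij Di).
  by case: (lt_absurd _ _ _ ji Dj).
have -> : (M%:R%:E * mu D = \sum_(i < M) mu D)%E.
  rewrite -[M in LHS]card_ord -sumr_const -sumEFin ge0_sume_distrl; last by [].
  by apply: eq_bigr => i _; rewrite mul1e.
rewrite [leLHS](_ : _ = mu (\big[setU/set0]_(i < M) (iter i F @^-1` D))).
  by apply: le_measure; rewrite ?inE//; exact: bigsetU_measurable.
rewrite measure_bigsetU_ord//; apply: eq_bigr => i _.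
have [_ _ _ _ muF] := iF.
by apply/esym/(measure_preimage_iter mF muF); exact: measurable_displaced.
Qed.

End displacement.

(** The witness [phi] is the backward first return to a marker set. That moved points start and end
    in [W] on one orbit is recorded because it later forces [phi] to preserve the first
    coordinate. *)
Lemma periodic_approximation d (Z : measurableType d) (R : realType)
    (mu : {measure set Z -> \bar R}) (F Fi : Z -> Z) (V : nat -> set Z)
    (G W : set Z) (p M : nat) :
  mp_iso mu F Fi ->
  (forall n, measurable (V n)) -> measurable W ->
  (forall (z : Z) (k : nat) (w : nat -> Z),
    exists n, V n z /\ forall i, (i < k)%N -> w i <> z -> ~ V n (w i)) ->
  W `<=` G -> (forall z, G z -> G (F z)) -> (forall z, G z -> G (Fi z)) ->
  (forall z, G z -> exists i, (i < p)%N /\ W (iter i F z)) ->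
  (0 < M)%N ->
  exists phi phii : Z -> Z, [/\ mp_iso mu phi phii,
    (forall z, phi z <> z -> W z /\ exists h, phi z = iter h Fi z /\ W (phi z)),
    (exists N, (0 < N)%N /\ forall z, G z -> iter N (phi \o F) z = z),
    measurable [set z | phi z <> z] &
    (M%:R%:E * mu [set z | phi z <> z] <= mu setT)%E].
Proof.
move=> iF mV mW sepV WG GF GFi GW M0; have [FK FiK mF mFi muF] := iF.
have [B [mB BW Bd Bh]] := marker_set FK mF mFi mV mW sepV M0.
have rF : recurrent F B by exact: (@recurrent_marker _ F Fi G W B p M).
have rFi : recurrent Fi B by exact: (@recurrent_marker_inv _ F Fi G W B p M).
have [_ _ _ _ muFi] := mp_iso_sym iF.
exists (induced Fi B), (induced F B); split.
- split; try exact: induced_can.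
  + exact: (measurable_induced FiK FK).
  + exact: (measurable_induced FK FiK).
  + by move=> C mC; apply: (measure_preimage_induced FiK FK).
- move=> z zD; have [Bz [h [hz Bphi]]] := induced_displaced rFi zD.
  by split; [exact: BW|exists h; split => //; exact: BW].
- exists ((M + p + M)`!); split; first exact: fact_gt0.
  exact: (@periodic_induced _ F Fi G W).
- exact: (measurable_displaced iF mV).
- exact: (measure_displaced iF mV).
Qed.

(** * The unit square *)

Section unit_square.
Variable R : realType.

Definition leb01 : set (measurableTypeR R) -> \bar R := @mX R.

HB.instance Definition _ := Measure.on leb01.

Lemma leb01T : leb01 setT = 1%E.
Proof.
by rewrite /leb01 /mX /= /mrestr setTI lebesgue_measure_itv /= lte_fin ltr01 oppr0 adde0.
Qed.

Let leb01_fin : fin_num_fun leb01.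
Proof.
move=> A mA; rewrite ge0_fin_numE ?measure_ge0//.
by rewrite (@le_lt_trans _ _ (leb01 setT)) ?leb01T ?ltry// -leb01T le_measure ?inE.
Qed.

HB.instance Definition _ := Measure_isFinite.Build _ _ _ leb01 leb01_fin.

Lemma leb01C : leb01 (~` I01) = 0%E.
Proof. by rewrite /leb01 /mX /= /mrestr setICl measure0. Qed.

(** [mZ] is typed as a bare set function; this copy carries its measure structure, as [leb01]
    carries the finite measure structure of [mX]. *)
Definition sq01 : set (R * R) -> \bar R := @mZ R.

Let sq01_0 : sq01 set0 = 0%E.
Proof. exact: (@measure0 _ _ _ (leb01 \x leb01)%E). Qed.

Let sq01_ge0 A : (0 <= sq01 A)%E.
Proof. exact: (@measure_ge0 _ _ _ (leb01 \x leb01)%E). Qed.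

Let sq01_sigma_additive : semi_sigma_additive sq01.
Proof. exact: (@measure_semi_sigma_additive _ _ _ (leb01 \x leb01)%E). Qed.

HB.instance Definition _ := isMeasure.Build _ _ _ sq01
  sq01_0 sq01_ge0 sq01_sigma_additive.

Lemma sq01X (A B : set R) : measurable A -> measurable B ->
  sq01 (A `*` B) = (leb01 A * leb01 B)%E.
Proof. by move=> mA mB; exact: (@product_measure1E _ _ _ _ _ leb01 leb01). Qed.

Lemma sq01T : sq01 setT = 1%E.
Proof. by rewrite -setXTT sq01X// !leb01T mule1. Qed.

Lemma measurable_DZ : measurable (@DZ R).
Proof. by apply: measurableX; exact: measurable_I01. Qed.

Lemma leb01_I01 : leb01 I01 = 1%E.
Proof.
by rewrite -leb01T /leb01 /mX /= /mrestr setIid setTI.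
Qed.

Lemma sq01_DZ : sq01 DZ = 1%E.
Proof.
by rewrite sq01X ?leb01_I01 ?mule1//; exact: measurable_I01.
Qed.

Lemma sq01C : sq01 (~` DZ) = 0%E.
Proof.
have := measureDI sq01 measurableT measurable_DZ.
rewrite setTD setTI => /(etrans (esym sq01T)) e.
have {e} : (1 = sq01 (~` DZ) + 1)%E by rewrite -[in RHS]sq01_DZ.
case: (sq01 (~` DZ)) => [r| |] //= [e]; congr EFin.
by apply: (@addIr _ 1); rewrite add0r -e.
Qed.

(* Finite intersections of rational half-planes [+/- coordinate < q] separate a
   point from finitely many others. *)
Definition half_plane (c : bool * bool * rat) : set (R * R) :=
  let: (b, s, q) := c in
  [set z | (if s then - (if b then z.1 else z.2) else if b then z.1 else z.2)
    < ratr q].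

Definition rat_polygon (s : seq (bool * bool * rat)) : set (R * R) :=
  [set z | forall c, c \in s -> half_plane c z].

Definition rat_polygon_enum n : set (R * R) :=
  if unpickle n is Some s then rat_polygon s else set0.

Lemma measurable_half_plane c : measurable (half_plane c).
Proof.
case: c => [[b s] q]; rewrite /half_plane.
pose f (z : R * R) := if s then - (if b then z.1 else z.2) else if b then z.1 else z.2.
rewrite (_ : [set _ | _] = f @^-1` `]-oo, (ratr q)[); last first.
  by apply/seteqP; split => z; rewrite /preimage /= in_itv.
apply: measurable_preimage; last exact: measurable_itv.
by rewrite {}/f; case: s; case: b => //; apply: measurableT_comp.
Qed.

Lemma measurable_rat_polygon_enum n : measurable (rat_polygon_enum n).
Proof.
rewrite /rat_polygon_enum; case: unpickle => // s.
elim: s => [|c s IH].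
  by rewrite (_ : rat_polygon _ = setT)//; apply/seteqP; split.
rewrite (_ : rat_polygon _ = half_plane c `&` rat_polygon s).
  by apply: measurableI => //; exact: measurable_half_plane.
apply/seteqP; split => [z zs|z [zc zs] c'].
  split; first by apply: zs; rewrite mem_head.
  by move=> c' c's; apply: zs; rewrite inE c's orbT.
by rewrite inE => /orP[/eqP->//|]; exact: zs.
Qed.

Lemma half_plane_sep (z w : R * R) : w <> z ->
  exists c, half_plane c z /\ ~ half_plane c w.
Proof.
move=> wz.
have sep1 (x y : R) : x < y -> exists q : rat, x < ratr q /\ ~ (y < ratr q).
  move=> /rat_in_itvoo[q]; rewrite in_itv/= => /andP[xq qy]; exists q; split => //.
  by apply/negP; rewrite -leNgt ltW.
have sep b x y : x = (if b then z.1 else z.2) -> y = (if b then w.1 else w.2) ->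
    y != x -> exists c, half_plane c z /\ ~ half_plane c w.
  move=> -> ->; rewrite neq_lt => /orP[|].
    rewrite -ltrN2 => /sep1[q qP]; exists (b, true, q) => //.
  by move=> /sep1[q qP]; exists (b, false, q).
have [e1|/(sep true _ _ erefl erefl)//] := eqVneq w.1 z.1.
have [e2|/(sep false _ _ erefl erefl)//] := eqVneq w.2 z.2.
by case: wz; rewrite [w]surjective_pairing [z]surjective_pairing e1 e2.
Qed.

(** One half-plane is added for each [w i] other than [z]; a [w i] equal to [z] needs none. *)
Lemma rat_polygon_sep (z : R * R) k (w : nat -> R * R) :
  exists n, rat_polygon_enum n z /\
    forall i, (i < k)%N -> w i <> z -> ~ rat_polygon_enum n (w i).
Proof.
suff [s [sz sw]] : exists s, rat_polygon s z /\
    forall i, (i < k)%N -> w i <> z -> ~ rat_polygon s (w i).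
  by exists (pickle s); rewrite /rat_polygon_enum pickleK.
elim: k => [|k [s [sz sw]]]; first by exists [::].
have [wz|wz] := pselect (w k = z).
  by exists s; split => // i; rewrite ltnS leq_eqVlt => /orP[/eqP->//|]; exact: sw.
have [c [cz cw]] := half_plane_sep wz.
exists (c :: s); split => [c'|i].
  by rewrite inE => /orP[/eqP->//|]; exact: sz.
rewrite ltnS leq_eqVlt => /orP[/eqP-> _ H|ik wi H].
  by apply: cw; apply: H; rewrite mem_head.
by apply: (sw _ ik wi) => c' c's; apply: H; rewrite inE c's orbT.
Qed.

End unit_square.

(** * Fibres of a vertical isomorphism *)

Section fibres.
Variable R : realType.
Local Notation RX := (measurableTypeR R).
Local Notation leb := (@leb01 R).
Local Notation sq := (@sq01 R).

(** A countable generating family closed under intersection: countably many almost-everywhere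
    identities, one per ray, then yield a statement about all measurable sets on almost every
    fibre. *)
Definition rat_ray (q : rat) : set RX := [set y : R | y < ratr q].

Lemma measurable_rat_ray q : measurable (rat_ray q).
Proof.
have -> : rat_ray q = `]-oo, (ratr q : R)[%classic.
  by apply/seteqP; split => y; rewrite /rat_ray/= in_itv.
exact: measurable_itv.
Qed.

Let RG := [set A | exists q, A = rat_ray q].

Lemma measurable_rat_rays : @measurable _ RX = <<s RG >>.
Proof.
apply/seteqP; split.
  rewrite [X in X `<=` _](RGenInftyO.measurableE R); apply: smallest_sub.
    exact: smallest_sigma_algebra.
  move=> _ [x ->].
  pose A n : set R := if unpickle n is Some q then
    if ratr q < x then rat_ray q else set0 else set0.
  rewrite (_ : `]-oo, x[%classic = \bigcup_n A n).
    apply: (@sigma_algebra_bigcup _ setT RG) => n; rewrite /A.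
    case: unpickle => [q|]; last exact: sigma_algebra0.
    case: ifP => _; last exact: sigma_algebra0.
    by apply: sub_sigma_algebra; exists q.
  apply/seteqP; split => [y|y [n _]]; rewrite /= in_itv/=.
    move=> /rat_in_itvoo[q]; rewrite in_itv/= => /andP[yq qx].
    exists (pickle q); first exact: I.
    by rewrite /A pickleK qx.
  rewrite /A; case: unpickle => // q; case: ifP => // qx yq.
  exact: lt_trans yq qx.
apply: smallest_sub; first exact: sigma_algebra_measurable.
by move=> _ [q ->]; exact: measurable_rat_ray.
Qed.

Lemma leb01_unique (f : RX -> RX) : measurable_fun setT f ->
  (forall q, leb (f @^-1` rat_ray q) = leb (rat_ray q)) ->
  forall A, measurable A -> leb (f @^-1` A) = leb A.
Proof.
move=> mf fq A mA.
apply: (@measure_unique _ _ _ RG (fun n => rat_ray n%:R) measurable_rat_rays _ _ _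
  (pushforward leb f) leb) => //.
- move=> _ _ [q ->] [r ->]; exists (Num.min q r); apply/seteqP; split => y.
    by move=> [yq yr]; rewrite /rat_ray /= minElt; case: ifP.
  rewrite /rat_ray/= minElt; case: (ltP q r) => qr yq; split => //=.
    by apply: (lt_trans yq); rewrite ltr_rat.
  by apply: (lt_le_trans yq); rewrite ler_rat.
- by move=> n; exists n%:R.
- apply/seteqP; split => // y _; exists (Num.bound `|y : R|) => //.
  rewrite /rat_ray /= ratr_nat; apply: le_lt_trans (ler_norm y) _.
  exact: archi_boundP (normr_ge0 _).
- by move=> _ [q ->]; exact: fq.
- move=> n; have : (leb (rat_ray n%:R) < +oo)%E.
    by rewrite -ge0_fin_numE ?measure_ge0// fin_num_measure//; exact: measurable_rat_ray.
  by rewrite -fq.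
Qed.

Lemma sq01E (A : set (R * R)) : sq A = (\int[leb]_x leb (xsection A x))%E.
Proof. by []. Qed.

Lemma measurable_fibre (phi : R * R -> R * R) (x : R) :
  measurable_fun setT phi -> measurable_fun setT (fun y : RX => (phi (x, y)).2 : RX).
Proof.
move=> mphi _ A mA; rewrite setTI.
rewrite (_ : _ @^-1` _ = xsection (phi @^-1` (setT `*` A)) x).
  apply: (@measurable_xsection _ _ RX RX); apply: measurable_preimage => //.
  exact: measurableX.
by apply/seteqP; split => y; rewrite /xsection /= inE; [split|case].
Qed.

Variables (phi phii : R * R -> R * R).
Hypotheses (iphi : mp_iso sq phi phii) (phi1 : forall z, (phi z).1 = z.1).
Hypothesis phiD : forall z, DZ z <-> DZ (phi z).

(** As [phi] is vertical and preserves [sq], the fibre measure integrates over every measurable [B]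
    to [leb (rat_ray q) * leb B]; a function with the integrals of a constant equals it almost
    everywhere. *)
Lemma ae_measure_fibre_rat_ray q : {ae leb, forall x : RX,
  leb ((fun y => (phi (x, y)).2) @^-1` rat_ray q) = leb (rat_ray q)}.
Proof.
have [_ _ mphi _ muphi] := iphi.
pose g (x : RX) : \bar R := leb ((fun y => (phi (x, y)).2 : RX) @^-1` rat_ray q).
pose P (B : set R) := phi @^-1` (B `*` rat_ray q).
have mP (B : set RX) : measurable B -> measurable (P B).
  move=> mB; apply: measurable_preimage => //.
  by apply: measurableX => //; exact: measurable_rat_ray.
have gP x : g x = leb (xsection (P setT) x).
  by congr (leb _); apply/seteqP; split => y; rewrite /P /xsection /= inE; [split|case].
have mg : measurable_fun setT g.
  rewrite (_ : g = fun x => leb (xsection (P setT) x)); last by apply/funext => x; exact: gP.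
  by apply: (@measurable_fun_xsection _ _ RX RX R leb); exact: mP.
have fin_q : leb (rat_ray q) \is a fin_num.
  by apply: fin_num_measure; exact: measurable_rat_ray.
suff : ae_eq leb setT (EFin \o cst (fine (leb (rat_ray q)))) g.
  by apply: filterS => x /(_ I) gx; rewrite -[LHS]/(g x) -gx /= fineK.
apply: integral_ae_eq => //.
  exact: finite_measure_integrable_cst.
move=> B _ mB.
rewrite [LHS](_ : _ = leb (rat_ray q) * leb B)%E; last first.
  by rewrite /comp/= fineK// integral_cst.
have := muphi (B `*` rat_ray q) (measurableX mB (measurable_rat_ray q)).
rewrite [in X in _ = X -> _]sq01X//; last exact: measurable_rat_ray.
rewrite muleC => <-; rewrite sq01E [RHS]integral_mkcond; apply: eq_integral => x _.
rewrite patchE; case: ifPn => xB.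
  congr (leb _); apply/seteqP; split => y; rewrite /xsection /= !inE /preimage/=.
    by move=> [].
  by split => //; rewrite phi1; exact/set_mem.
rewrite (_ : xsection _ _ = set0) ?measure0//.
apply/seteqP; split => // y; rewrite /xsection /= inE => -[/=]; rewrite phi1 /= => Bx _.
by rewrite mem_set in xB.
Qed.

(** Off one null set all rational rays are preserved simultaneously, hence all measurable sets by
    [leb01_unique]; the fibre of [phii] is the inverse. *)
Lemma ae_inv_mpt_fibre : {ae leb, forall x : RX,
  I01 x -> inv_mpt mX I01 (fun y => (phi (x, y)).2)}.
Proof.
have [phiK phiiK mphi mphii muphi] := iphi.
have phii1 z : (phii z).1 = z.1 by rewrite -[in RHS](phiiK z) phi1.
have : {ae leb, forall x : RX, forall n, leb ((fun y => (phi (x, y)).2) @^-1`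
    rat_ray (odflt 0 (unpickle n))) = leb (rat_ray (odflt 0 (unpickle n)))}.
  by apply: ae_foralln => n; exact: ae_measure_fibre_rat_ray.
apply: filterS => x xq x01.
have pair_phi y : phi (x, y) = (x, (phi (x, y)).2).
  by rewrite [LHS]surjective_pairing phi1.
have pair_phii y : phii (x, y) = (x, (phii (x, y)).2).
  by rewrite [LHS]surjective_pairing phii1.
apply: (@mp_iso_inv_mpt _ _ _ leb I01 measurable_I01 (leb01C R) _ (fun y => (phii (x, y)).2)).
  split.
  - by move=> y; rewrite -pair_phi phiK.
  - by move=> y; rewrite -pair_phii phiiK.
  - exact: measurable_fibre.
  - exact: measurable_fibre.
  apply: leb01_unique; first exact: measurable_fibre.
  by move=> q; have := xq (pickle q); rewrite pickleK.
move=> y; have := phiD (x, y); rewrite pair_phi /DZ /= => -[h1 h2].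
by split => y01; [have [] := h1 (conj x01 y01)|have [] := h2 (conj x01 y01)].
Qed.

End fibres.

(** * Density of periodic extensions *)

(** A point gained by the image is moved by [fi], and a point lost is moved by [f]; the bound does
    not depend on [B]. *)
Lemma symdiff_image_sub (Z : Type) (f fi : Z -> Z) (B : set Z) :
  cancel f fi -> symdiff (f @` B) B `<=` [set z | fi z <> z] `|` [set z | f z <> z].
Proof.
move=> fK z [[[w Bw <-] nB]|[Bz nz]].
  by left => /=; rewrite fK => E; apply: nB; rewrite -E.
by right => /= E; apply: nz; exists z.
Qed.

Lemma iter_modn (T : Type) (f : T -> T) p n x : iter p f x = x ->
  iter (n %% p) f x = iter n f x.
Proof.
move=> px; rewrite [in RHS](divn_eq n p) addnC iterD; congr (iter _ f _).
by elim: (n %/ p)%N => // m IH; rewrite mulSn iterD -IH.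
Qed.

Section periodic_dense.
Variable R : realType.
Local Notation leb := (@leb01 R).
Local Notation sq := (@sq01 R).

Lemma negligible_cylinder (N : set R) : leb.-negligible N ->
  sq.-negligible (N `*` setT).
Proof.
move=> [A [mA A0 NA]]; exists (A `*` setT); split; first exact: measurableX.
  by rewrite sq01X// A0 mul0e.
by move=> z [/NA].
Qed.

Lemma negligible_preimage (F Fi : R * R -> R * R) N : mp_iso sq F Fi ->
  sq.-negligible N -> sq.-negligible (F @^-1` N).
Proof.
move=> [_ _ mF _ muF] [A [mA A0 NA]]; exists (F @^-1` A); split.
- exact: measurable_preimage.
- by rewrite muF.
- by move=> z /NA.
Qed.

Lemma negligible_preimage_inv_mpt (f : R -> R) (N : set R) : inv_mpt mX I01 f ->
  leb.-negligible N -> leb.-negligible (I01 `&` f @^-1` N).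
Proof.
move=> [_ mf _ muf] [A [mA A0 NA]]; exists (I01 `&` f @^-1` A); split.
- exact: (mf measurable_I01).
- by rewrite -A0; exact: muf.
- by move=> x [x01 /NA].
Qed.

Section core.
Variables (F Fi : R * R -> R * R) (G0 : set (R * R)).
Hypothesis iF : mp_iso sq F Fi.
Hypothesis mG0 : measurable G0.

(** The points whose whole two-sided orbit stays in [G0]: properties valid almost everywhere hold
    there at every time, and its complement is still null. *)
Definition invariant_core := \bigcap_n (iter n F @^-1` G0 `&` iter n Fi @^-1` G0).

Lemma invariant_core_sub : invariant_core `<=` G0.
Proof. by move=> z /(_ 0%N I)[]. Qed.

Lemma measurable_invariant_core : measurable invariant_core.
Proof.
have [_ _ mF mFi _] := iF.
by apply: bigcapT_measurable => n; apply: measurableI;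
  apply: measurable_preimage => //; exact: measurable_iter.
Qed.

Lemma invariant_core_F z : invariant_core z -> invariant_core (F z).
Proof.
have [FK _ _ _ _] := iF; move=> Gz n _; split; rewrite /preimage /=.
  by rewrite -iterSr; have [] := Gz n.+1 I.
case: n => [|n]; first by have [] := Gz 1%N I.
by rewrite iterSr FK; have [] := Gz n I.
Qed.

Lemma invariant_core_Fi z : invariant_core z -> invariant_core (Fi z).
Proof.
have [_ FiK _ _ _] := iF; move=> Gz n _; split; rewrite /preimage /=; last first.
  by rewrite -iterSr; have [] := Gz n.+1 I.
case: n => [|n]; first by have [] := Gz 1%N I.
by rewrite iterSr FiK; have [] := Gz n I.
Qed.

Lemma negligible_invariant_core : sq.-negligible (~` G0) ->
  sq.-negligible (~` invariant_core).
Proof.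
move=> nG0; rewrite setC_bigcap; apply: negligible_bigcup => n.
rewrite setCI; apply: negligibleU; rewrite preimage_setC.
  exact: (negligible_preimage (mp_iso_iter n iF)).
exact: (negligible_preimage (mp_iso_iter n (mp_iso_sym iF))).
Qed.

End core.

Variables (T0 : R -> R) (p : nat).
Hypotheses (hT0 : inv_mpt mX I01 T0) (p_gt0 : (0 < p)%N).

Variables (F Fi : R * R -> R * R) (G : set (R * R)).
Hypotheses (iF : mp_iso sq F Fi) (mG : measurable G).
Hypotheses (GF : forall z, G z -> G (F z)) (GFi : forall z, G z -> G (Fi z)).
Hypothesis F1 : forall z, G z -> (F z).1 = T0 z.1.
Hypothesis GT0p : forall z, G z -> iter p T0 z.1 = z.1.

Let iterG n z : G z -> G (iter n F z).
Proof. by move=> Gz; elim: n => //= n; exact: GF. Qed.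

Let iterF1 n z : G z -> (iter n F z).1 = iter n T0 z.1.
Proof. by move=> Gz; elim: n => //= n IH; rewrite F1 ?IH//; exact: iterG. Qed.

(* A measurable fundamental domain for [T0], times the fibre: the points lying above
   the leftmost element of their finite [T0]-orbit. *)
Definition leftmost := G `&` [set z | forall i, (i < p)%N -> z.1 <= (iter i F z).1].

Lemma measurable_leftmost : measurable leftmost.
Proof.
have [_ _ mF _ _] := iF; apply: measurableI => //.
rewrite (_ : [set _ | _] = \bigcap_(i in [set i | (i < p)%N])
    ((fun z => (iter i F z).1 - z.1) @^-1` `[0, +oo[)); last first.
  by apply/seteqP; split => z zi i /zi; rewrite /preimage/= in_itv/= andbT subr_ge0.
apply: bigcap_measurableType => i _; apply: measurable_preimage => //.
apply: measurable_funB => //; apply: measurableT_comp => //.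
exact: measurable_iter.
Qed.

(** The first coordinate attains its minimum over one period; reduction modulo [p] makes it minimal
    among all later iterates. *)
Lemma leftmost_hit z : G z -> exists i, (i < p)%N /\ leftmost (iter i F z).
Proof.
move=> Gz; pose i0 := Ordinal p_gt0.
case: (@arg_minP _ R 'I_p i0 xpredT (fun i => iter i T0 z.1)) => // i _ imin.
exists i; split => //; split; first exact: iterG.
move=> j jp /=; rewrite -iterD !iterF1// -(iter_modn (j + i) (GT0p Gz)).
exact: (imin (Ordinal (ltn_pmod (j + i) p_gt0))).
Qed.

Lemma leftmost_le n z : leftmost z -> z.1 <= iter n T0 z.1.
Proof.
move=> [Gz zi]; rewrite -(iter_modn n (GT0p Gz)) -iterF1//.
by apply: zi; rewrite ltn_pmod.
Qed.

(** The two first coordinates are [T0]-iterates of one another and each is least on its orbit, so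
    each is at most the other. *)
Lemma leftmost_return n z : leftmost z -> leftmost (iter n Fi z) ->
  (iter n Fi z).1 = z.1.
Proof.
have [FK FiK _ _ _] := iF.
move=> Wz Ww; set w := iter n Fi z in Ww *.
have zE : z.1 = iter n T0 w.1.
  by rewrite -iterF1 ?/w ?iter_can//; case: Ww.
(* As [p * n] steps of [T0] act trivially here, [p * n - n] forward steps undo [n] of them. *)
have wE : w.1 = iter (p * n - n) T0 z.1.
  rewrite zE -iterD subnK ?leq_pmull//.
  by rewrite -(iter_modn _ (GT0p (proj1 Ww))) modnMr.
by apply/eqP; rewrite eq_le [X in _ <= X]zE leftmost_le// wE leftmost_le.
Qed.

Lemma vertical_GT0 (Tf : R -> R -> R) (phi phii : R * R -> R * R) :
  mp_iso sq phi phii -> (forall z, (phi z).1 = z.1) ->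
  (forall z, DZ z <-> DZ (phi z)) -> (forall z, DZ z <-> DZ (F z)) ->
  (forall x, x \in I01 -> inv_mpt mX I01 (Tf x)) ->
  G `<=` DZ -> sq.-negligible (~` G) ->
  (forall z, G z -> F z = (T0 z.1, Tf z.1 z.2)) ->
  GT0 T0 (phi \o F).
Proof.
move=> iphi phi1 phiD FD Tfi GD nG GE; split.
  have H z : DZ z <-> DZ ((phi \o F) z) by rewrite (FD z) (phiD (F z)).
  exact: (mp_iso_inv_mpt (@measurable_DZ R) (sq01C R) (mp_iso_comp iphi iF) H).
pose good x := inv_mpt mX I01 (fun y => (phi (x, y)).2).
(* Every fibre map must be invertible, while [phi] has good fibres only almost everywhere; [Tf x]
   fills in elsewhere. Those [x] form a null set because [T0] pulls null sets back to null sets. *)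
exists (fun x => if pselect (good (T0 x)) then
  (fun y => (phi (T0 x, Tf x y)).2) else Tf x); split.
  move=> x x01; case: pselect => gx; last exact: Tfi.
  exact: (inv_mpt_comp (mu := leb) (@measurable_I01 R) gx (Tfi x x01)).
have /(negligible_preimage_inv_mpt hT0)/negligible_cylinder nN :=
  ae_inv_mpt_fibre iphi phi1 phiD.
have [A [mA A0 NA]] := negligibleU nG nN.
exists A; split => //; apply: subset_trans NA => z /= zN.
have [Gz|] := pselect (G z); last by left.
right; split => //=; have [z1 _] := GD _ Gz; split => // gx.
apply: zN; rewrite /= GE//=; case: pselect => [gd|ng] /=.
  by rewrite [LHS]surjective_pairing phi1.
case: ng; apply: gx.
by have [[T0I _ _] _ _ _] := hT0; exact: T0I.
Qed.

End periodic_dense.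

(** The approximant is [phi \o F], with [F] agreeing with [T] on the square. Image sets change only
    where [phi] moves points, so one displacement bound serves all test sets. Periodicity holds on a
    conull core, hence the conclusion up to measure 0. *)
Lemma periodic_extension_dense (R : realType) (T0 : R -> R)
    (T : R * R -> R * R) (Es : nat -> set (R * R)) (eps : R) :
  inv_mpt mX I01 T0 -> periodic_map T0 -> GT0 T0 T ->
  (forall i, measurable (Es i)) -> 0 < eps ->
  exists S, [/\ GT0 T0 S, (forall k, wnbhs T k Es eps S) &
    exists N, (0 < N)%N /\ forall m E, measurable E -> E `<=` DZ ->
      mZ (symdiff (iter (m * N) S @` E) E) = 0%E].
Proof.
move=> hT0 [p [p0 T0p]] [hT [Tf [Tfi TE]]] mEs eps0.
have [F [Fi [iF FT FD FN]]] := inv_mpt_mp_iso (@measurable_DZ R) (sq01C R) hT.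
have FDE z : DZ z <-> DZ (F z).
  by split; [exact: FD|move=> DF; apply: contrapT => nD; move: (nD); rewrite -{1}(FN _ nD)].
have [N1 [mN1 N10 TN1]] := TE.
have [N2 [mN2 N20 TN2]] := T0p.
pose G0 := DZ `\` (N1 `|` N2 `*` setT) : set (R * R).
have mN2T : measurable (N2 `*` setT : set (R * R)) by apply: measurableX.
have mG0 : measurable G0.
  by apply: measurableD; [exact: measurable_DZ|exact: measurableU].
have nG0 : (@sq01 R).-negligible (~` G0).
  rewrite /G0 setDE setCI setCK; apply: negligibleU.
    exists (~` @DZ R); split; last exact: subset_refl.
      exact: (measurableC (@measurable_DZ R)).
    exact: (sq01C R).
  apply: negligibleU; first by exists N1; split.
  by apply: negligible_cylinder; exists N2; split.
pose G := @invariant_core R F Fi G0.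
have mG : measurable G := @measurable_invariant_core R F Fi G0 iF mG0.
have nG : (@sq01 R).-negligible (~` G) := @negligible_invariant_core R F Fi G0 iF nG0.
have GF z : G z -> G (F z) := @invariant_core_F R F Fi G0 iF z.
have GFi z : G z -> G (Fi z) := @invariant_core_Fi R F Fi G0 iF z.
have GG0 : G `<=` G0 := @invariant_core_sub R F Fi G0.
have GD : G `<=` DZ by move=> z /GG0[].
have GE z : G z -> F z = (T0 z.1, Tf z.1 z.2).
  move=> /GG0[Dz nz]; rewrite FT//; apply: contrapT => zN.
  by apply: nz; left; exact: TN1.
have F1 z : G z -> (F z).1 = T0 z.1 by move=> /GE->.
have GT0p z : G z -> iter p T0 z.1 = z.1.
  move=> /GG0[_ nz]; apply: contrapT => zN; apply: nz; right; split => //.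
  exact: TN2.
(* This gives [1 / M < eps], and the successor makes [M] positive by computation. *)
pose M := (Num.bound eps^-1).+1.
have [phi [phii [iphi phiW [N [N0 phiN]] mDphi Dphi]]] :=
  periodic_approximation (M := M) iF (@measurable_rat_polygon_enum R)
    (measurable_leftmost p iF mG) (@rat_polygon_sep R) (@subIsetl _ _ _) GF GFi
    (leftmost_hit p0 GF F1 GT0p) isT.
have [phiK _ _ _ _] := iphi.
have phi1 z : (phi z).1 = z.1.
  have [->//|/eqP/phiW[Wz [h [zh Wphi]]]] := eqVneq (phi z) z.
  by rewrite zh; rewrite zh in Wphi; exact: (leftmost_return p0 iF GF F1 GT0p Wz Wphi).
have phiD z : DZ z <-> DZ (phi z).
  have [->//|/eqP/phiW[Wz [h [_ Wphi]]]] := eqVneq (phi z) z.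
  by split => _; [exact: GD (proj1 Wphi)|exact: GD (proj1 Wz)].
exists (phi \o F); split.
- exact: (vertical_GT0 hT0 iF iphi phi1 phiD FDE Tfi GD nG GE).
- move=> k i _.
  pose B := T @` (DZ `&` Es i).
  have mB : measurable B by have [_ _ mT _] := hT; exact: mT.
  have -> : (phi \o F) @` (DZ `&` Es i) = phi @` B.
    rewrite image_comp; apply: eq_imagel => z [Dz _] /=; by rewrite FT.
  have phiiD z : phii z <> z -> phi z <> z.
    by move=> nz zz; apply: nz; rewrite -[in LHS]zz phiK.
  have sub : symdiff (phi @` B) B `<=` [set z | phi z <> z].
    apply: subset_trans (symdiff_image_sub (B := B) phiK) _ => z [|//].
    exact: phiiD.
  have mS : measurable (symdiff (phi @` B) B).
    have mphiB := measurable_image_iso iphi mB.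
    by apply: measurableU; apply: measurableD.
  apply: (@le_lt_trans _ _ (sq01 [set z | phi z <> z])).
    by apply: (le_measure (@sq01 R)); rewrite ?inE.
  have {}Dphi : (M%:R%:E * sq01 [set z | phi z <> z] <= 1)%E.
    by rewrite -(sq01T R); exact: Dphi.
  have : sq01 [set z | phi z <> z] \is a fin_num.
    rewrite ge0_fin_numE ?measure_ge0// (@le_lt_trans _ _ 1%E) ?ltry//.
    by rewrite -(sq01T R) le_measure ?inE.
  move: Dphi; case: (sq01 _) => // r; rewrite -EFinM !lee_fin lte_fin => rM _.
  have M0 : 0 < M%:R :> R by rewrite ltr0n.
  rewrite -(ltr_pM2l M0) (le_lt_trans rM)// mulrC -ltr_pdivrMl// mulr1.
  apply: lt_le_trans (archi_boundP (ltW _)) _; first by rewrite invr_gt0.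
  by rewrite ler_nat.
exists N; split => // m E mE ED.
have [SK SiK _ _ _] := mp_iso_iter (m * N) (mp_iso_comp iphi iF).
have SG z : G z -> iter (m * N) (phi \o F) z = z.
  by move=> Gz; elim: m {SK SiK} => // m IH; rewrite mulSn iterD IH phiN.
have [A [mA A0 GA]] := nG.
apply: (subset_measure0 (mu := @sq01 R) _ mA _ A0).
  have mSE := measurable_image_iso (mp_iso_iter (m * N) (mp_iso_comp iphi iF)) mE.
  by apply: measurableU; apply: measurableD.
apply: subset_trans (symdiff_image_sub (B := E) SK) _ => z zN; apply: GA => Gz.
have zz := SG _ Gz.
by case: zN => /=; apply => //; rewrite -[in LHS]zz SK.
Qed.

(** * Openness in the weak topology *)

Lemma measurable_symdiff d (Z : measurableType d) (A B : set Z) :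
  measurable A -> measurable B -> measurable (symdiff A B).
Proof. by move=> mA mB; apply: measurableU; apply: measurableD. Qed.

Lemma symdiff_triangle d (Z : measurableType d) (R : realType)
    (mu : {measure set Z -> \bar R}) (A B C : set Z) :
  measurable A -> measurable B -> measurable C ->
  (mu (symdiff A C) <= mu (symdiff A B) + mu (symdiff B C))%E.
Proof.
move=> mA mB mC.
have mAC := measurable_symdiff mA mC.
have mAB := measurable_symdiff mA mB.
have mBC := measurable_symdiff mB mC.
have mU := measurableU _ _ mAB mBC.
apply: (@le_trans _ _ (mu (symdiff A B `|` symdiff B C))); last exact: measureU2.
rewrite le_measure ?inE// => z.
by rewrite /symdiff /=; have [] := pselect (B z); tauto.
Qed.

Section topology.
Variable R : realType.
Local Notation sq := (@sq01 R).

(** [S] is unconstrained off the square; orbits starting in the square never leave it, so [F] can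
    replace [S] along them. *)
Lemma mp_iso_on_DZ (S : R * R -> R * R) : inv_mpt mZ DZ S ->
  exists F Fi, mp_iso sq F Fi /\ forall n z, DZ z ->
    iter n S z = iter n F z /\ DZ (iter n F z).
Proof.
move=> hS; have [F [Fi [iF FS FD _]]] := inv_mpt_mp_iso (@measurable_DZ R) (sq01C R) hS.
exists F, Fi; split => // n z Dz.
by elim: n => [//|n [IH1 IH2]]; rewrite !iterS IH1 -FS//; split => //; exact: FD.
Qed.

Lemma image_iter_on_DZ (S F : R * R -> R * R) (A : set (R * R)) n : A `<=` DZ ->
  (forall n z, DZ z -> iter n S z = iter n F z /\ DZ (iter n F z)) ->
  iter n S @` A = iter n F @` A /\ iter n F @` A `<=` DZ.
Proof.
move=> AD SF; split; last by move=> _ [z /AD Dz <-]; have [] := SF n z Dz.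
by apply: eq_imagel => z /AD Dz; have [] := SF n z Dz.
Qed.

(** Telescoping: [S] preserves the distance between the [k]-th images, and one further [e] pays for
    replacing [S] by [T] on the [k]-th image under [T]. Only images under [T] need be tested, so
    they can be fixed in advance. *)
Lemma iter_image_close (S T : R * R -> R * R) (E : set (R * R)) (e : R) k :
  inv_mpt mZ DZ S -> inv_mpt mZ DZ T -> measurable E -> E `<=` DZ ->
  (forall j, (j < k)%N -> (mZ (symdiff (S @` (DZ `&` iter j T @` E))
      (T @` (DZ `&` iter j T @` E))) < e%:E)%E) ->
  (mZ (symdiff (iter k S @` E) (iter k T @` E)) <= (e *+ k)%:E)%E.
Proof.
move=> hS hT mE ED.
have [F [Fi [iF SF]]] := mp_iso_on_DZ hS.
have [G [Gi [iG TG]]] := mp_iso_on_DZ hT.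
elim: k => [_|k IH close].
  rewrite mulr0n (_ : symdiff _ _ = set0); first by rewrite [leLHS](measure0 sq).
  by apply/seteqP; split => // z [[]|[]].
have {}IH := IH (fun j jk => close j (ltnW jk)).
have [SE SED] := image_iter_on_DZ k ED SF.
have [TE TED] := image_iter_on_DZ k ED TG.
have imS (A : set (R * R)) : A `<=` DZ -> S @` A = F @` A.
  by move=> AD; have [] := image_iter_on_DZ 1 AD SF.
have imT (A : set (R * R)) : A `<=` DZ -> T @` A = G @` A.
  by move=> AD; have [] := image_iter_on_DZ 1 AD TG.
have iterE (f : R * R -> R * R) : iter k.+1 f @` E = f @` (iter k f @` E).
  by rewrite image_comp.
have mSk := measurable_image_iso (mp_iso_iter k iF) mE.
have mTk := measurable_image_iso (mp_iso_iter k iG) mE.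
have := close k (ltnSn k); rewrite setIidr ?TE// => {}close.
rewrite !iterE SE TE; rewrite SE TE in IH.
rewrite (imS _ SED) (imT _ TED); rewrite (imS _ TED) (imT _ TED) in close.
apply: le_trans (symdiff_triangle sq (measurable_image_iso iF mSk)
  (measurable_image_iso iF mTk) (measurable_image_iso iG mTk)) _.
rewrite mulrSr EFinD; apply: leeD; last exact: ltW.
have [FK FiK _ _ _] := iF; have [_ _ _ _ muFi] := mp_iso_sym iF.
rewrite !(image_can _ FK FiK); rewrite [leLHS](muFi (symdiff _ _)) //.
exact: measurable_symdiff.
Qed.

Lemma wopen_recurrent (T0 : R -> R) (U : set (R * R -> R * R)) (E : set (R * R))
    (c : R) (k : nat) : measurable E -> E `<=` DZ -> Defs.wopen (GT0 T0) U ->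
  Defs.wopen (GT0 T0) (U `&` [set S : R * R -> R * R |
    (mZ (symdiff (iter k S @` E) E) < c%:E)%E]).
Proof.
move=> mE ED [UG Unbhs]; split; first by move=> S [/UG].
move=> T [UT /= Tc].
have [k1 [Es1 [e1 [mEs1 e10 U1]]]] := Unbhs _ UT.
have [hT _] := UG _ UT.
have [G [Gi [iG TG]]] := mp_iso_on_DZ hT.
have mT j : measurable (iter j T @` E).
  have [-> _] := image_iter_on_DZ j ED TG.
  exact: (measurable_image_iso (mp_iso_iter j iG) mE).
have [r rE] : exists r : R, mZ (symdiff (iter k T @` E) E) = r%:E.
  exists (fine (mZ (symdiff (iter k T @` E) E))); rewrite fineK//.
  rewrite ge0_fin_numE; first exact: lt_le_trans Tc (leey _).
  exact: (measure_ge0 sq).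
rewrite rE lte_fin in Tc.
(* The slack [c - r] is shared among [k + 1] parts so that [k] errors stay strictly below it, even
   for [k = 0]. *)
pose e2 := (c - r) / k.+1%:R.
have e20 : 0 < e2 by rewrite divr_gt0// ?subr_gt0// ltr0n.
exists (k1 + k)%N, (fun i => if (i < k1)%N then Es1 i else iter (i - k1) T @` E),
  (Num.min e1 e2); split.
- by move=> i; case: ifP.
- by rewrite lt_min e10.
move=> S [GS Snbhs]; split.
  apply: U1; split => // i ik1.
  have := Snbhs i (leq_trans ik1 (leq_addr _ _)); rewrite ik1 => /lt_le_trans; apply.
  by rewrite lee_fin ge_min lexx.
have close j : (j < k)%N -> (mZ (symdiff (S @` (DZ `&` iter j T @` E))
      (T @` (DZ `&` iter j T @` E))) < e2%:E)%E.
  move=> jk; have /Snbhs : (k1 + j < k1 + k)%N by rewrite ltn_add2l.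
  rewrite ltnNge leq_addr addKn /= => /lt_le_trans; apply.
  by rewrite lee_fin ge_min lexx orbT.
have [hS _] := GS.
have [F [Fi [iF SF]]] := mp_iso_on_DZ hS.
have mS : measurable (iter k S @` E).
  have [-> _] := image_iter_on_DZ k ED SF.
  exact: (measurable_image_iso (mp_iso_iter k iF) mE).
apply: le_lt_trans (symdiff_triangle sq mS (mT k) mE) _.
rewrite [X in (_ + X)%E]rE.
apply: (@le_lt_trans _ _ ((e2 *+ k)%:E + r%:E)%E).
  by apply: leeD => //; exact: iter_image_close.
rewrite -EFinD lte_fin -ltrBrDr -mulr_natl mulrC /e2 -mulrA gtr_pMr ?subr_gt0//.
by rewrite mulrC ltr_pdivrMr ?mul1r ?ltr_nat// ltr0n.
Qed.

End topology.

(** * Mixing *)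

Section mixing.
Variable R : realType.
Local Notation RX := (measurableTypeR R).
Local Notation leb := (@leb01 R).
Local Notation sq := (@sq01 R).

Definition lower_half : set (R * R) := [set z | z.2 <= 2^-1].
Definition half_square : set (R * R) := DZ `&` lower_half.
Definition half_indic (z : R * R) : R[i] := (\1_lower_half z +i* 0)%C.

Lemma lower_halfE : lower_half = setT `*` `]-oo, 2^-1].
Proof. by apply/seteqP; split => z; rewrite /lower_half /= in_itv/=; [split|case]. Qed.

Lemma measurable_lower_half : measurable lower_half.
Proof. by rewrite lower_halfE; apply: measurableX. Qed.

Lemma measurable_half_square : measurable half_square.
Proof. by apply: measurableI; [exact: measurable_DZ|exact: measurable_lower_half]. Qed.

Lemma leb01_lower_half : leb `]-oo, 2^-1] = (2^-1)%:E.
Proof.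
rewrite /leb01 /mX /= /mrestr.
rewrite (_ : _ `&` _ = `[0, 2^-1]%classic); last first.
  apply/seteqP; split => y; rewrite /I01 /= !in_itv/=.
    by move=> [-> /andP[->]].
  move=> /andP[-> yh]; split => //=; apply: (le_trans yh).
  by rewrite invf_le1// ler1n.
by rewrite lebesgue_measure_itv /= lte_fin invr_gt0 ltr0n /= oppr0 adde0.
Qed.

Lemma leb01_setI (A : set RX) : leb (A `&` I01) = leb A.
Proof.
change (lebesgue_measure (A `&` I01 `&` I01) = lebesgue_measure (A `&` I01)).
by rewrite -setIA setIid.
Qed.

Lemma sq01_half_square : sq half_square = (2^-1)%:E.
Proof.
have -> : half_square = I01 `*` (I01 `&` `]-oo, 2^-1]).
  by apply/seteqP; split => z; rewrite /half_square lower_halfE /DZ /=; tauto.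
rewrite sq01X; first last.
- by apply: measurableI => //; exact: measurable_I01.
- exact: measurable_I01.
by rewrite leb01_I01 mul1e setIC leb01_setI leb01_lower_half.
Qed.

Lemma Rintegral_leb01_indic (A : set RX) : measurable A ->
  Rintegral mX I01 (\1_A : RX -> R) = fine (leb A).
Proof.
move=> mA; rewrite /Rintegral.
rewrite [X in fine X](_ : _ = \int[leb]_(x in I01) (\1_A x)%:E)%E//.
rewrite integral_indic//; last exact: measurable_I01.
by rewrite [X in fine X = _]leb01_setI.
Qed.

Lemma lower_half_section x y :
  \1_lower_half (x, y) = \1_(`]-oo, 2^-1] : set RX) y :> R.
Proof.
rewrite !indicE lower_halfE; congr ((_ : bool)%:R).
by apply/idP/idP => /set_mem; [move=> [_ yh]; exact/mem_set|move=> yh; exact/mem_set].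
Qed.

Lemma csq_half_indic z : csq (half_indic z) = \1_lower_half z.
Proof.
by rewrite /csq /half_indic /= expr0n addr0 indicE; case: (_ \in _); rewrite ?expr1n ?expr0n.
Qed.

Lemma L2ZX_half_indic : L2ZX half_indic.
Proof.
split.
- by apply: measurable_funTS; apply: measurable_indic; exact: measurable_lower_half.
- exact: measurable_cst.
- rewrite [ltLHS](_ : _ = \int[sq]_(z in DZ) (\1_lower_half z)%:E)%E; last first.
    by apply: (@eq_integral _ _ R sq) => z _; rewrite csq_half_indic.
  rewrite integral_indic; [|exact: measurable_DZ|exact: measurable_lower_half].
  rewrite setIC [ltLHS](_ : _ = sq half_square)//.
  by rewrite sq01_half_square ltry.
exists 1; apply: aeW => x.
rewrite [leLHS](_ : _ = \int[leb]_(y in I01) (\1_(`]-oo, 2^-1] : set RX) y)%:E)%E; last first.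
  apply: (@eq_integral _ _ R leb) => y _.
  by rewrite csq_half_indic lower_half_section.
rewrite integral_indic//; last exact: measurable_I01.
apply: (@le_trans _ _ (leb setT)); last by rewrite leb01T.
by rewrite le_measure ?inE//; apply: measurableI => //; exact: measurable_I01.
Qed.

Lemma condexpX_half_indic x : condexpX half_indic x = (2^-1 +i* 0)%C.
Proof.
rewrite /condexpX /cintX /half_indic /=; congr (_ +i* _)%C.
  rewrite (_ : (fun y => _) = \1_(`]-oo, 2^-1] : set RX)).
    by rewrite Rintegral_leb01_indic// leb01_lower_half.
  by apply/funext => y; exact: lower_half_section.
by rewrite /Rintegral integral0.
Qed.

Lemma conj_half_indic z : ((half_indic z)^* = half_indic z)%R.
Proof. by rewrite /half_indic /Num.conj /= oppr0. Qed.

(** * Self-correlation of the half square *)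

Section correlation.
Variables (S F Fi : R * R -> R * R) (n : nat).
Hypotheses (iF : mp_iso sq F Fi).
Hypothesis SF : forall n z, DZ z -> iter n S z = iter n F z /\ DZ (iter n F z).

Let P := half_square `&` iter n F @^-1` half_square.

Let mP : measurable P.
Proof.
have [_ _ mF _ _] := mp_iso_iter n iF.
apply: measurableI; first exact: measurable_half_square.
by apply: measurable_preimage => //; exact: measurable_half_square.
Qed.

Let mPx x : measurable (xsection P x : set RX).
Proof. exact: (@measurable_xsection _ _ RX RX). Qed.

(** The correlation on the fibre over [x]; mixing drives it to [1/4] in the quadratic mean. *)
Let a (x : RX) : R := fine (leb (xsection P x)).

Let leb_fin x : leb (xsection P x) = (a x)%:E.
Proof. by rewrite /a fineK//; exact: (fin_num_measure leb). Qed.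

Let a_ge0 x : 0 <= a x.
Proof. by rewrite -lee_fin -leb_fin; exact: (measure_ge0 leb). Qed.

Let ma : measurable_fun setT a.
Proof.
apply/measurable_EFinP.
rewrite (_ : _ \o _ = leb \o xsection P); last by apply/funext => x; rewrite /= leb_fin.
exact: (@measurable_fun_xsection _ _ RX RX R leb).
Qed.

Lemma condexpX_correlation x : x \in I01 ->
  condexpX (fun z => half_indic (iter n S z) * (half_indic z)^*) x = (a x +i* 0)%C.
Proof.
move=> /set_mem x01; rewrite /condexpX /cintX; congr (_ +i* _)%C.
  rewrite /a -Rintegral_leb01_indic//; apply: eq_Rintegral => y /set_mem y01.
  rewrite conj_half_indic /half_indic /= mul0r subr0 !indicE -natrM mulnb.
  congr ((_ : bool)%:R).
  have [-> DF] := SF n (conj x01 y01 : DZ (x, y)).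
  apply/idP/idP => [/andP[/set_mem h1 /set_mem h2]|/set_mem].
    by apply/mem_set; rewrite /xsection /=; apply/mem_set.
  rewrite /xsection /= => /set_mem[[_ h1] [_ h2]].
  by apply/andP; split; exact/mem_set.
rewrite /Rintegral (@eq_integral _ _ R leb _ (cst 0%E)) ?integral0// => y _.
by rewrite conj_half_indic /half_indic /= mulr0 mul0r addr0.
Qed.

(** Passes from the squared deviation controlled by mixing to the measure of [P], with a pointwise
    inequality in place of Cauchy-Schwarz; [5/16] is [1/4 + 1/16]. *)
Lemma correlation_bound :
  (sq P <= (5 / 16)%:E + 4%:E * \int[leb]_(x in I01) ((a x - 4^-1) ^+ 2)%:E)%E.
Proof.
have mI : measurable (I01 : set RX) by exact: measurable_I01.
have msq : measurable_fun I01 (fun x : RX => (a x - 4^-1) ^+ 2).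
  apply: measurable_funX; apply: measurable_funB => //.
  exact: measurable_funTS.
have -> : sq P = (\int[leb]_(x in I01) (a x)%:E)%E.
  rewrite sq01E [RHS]integral_mkcond; apply: eq_integral => x _.
  rewrite patchE; case: ifPn => [_|/negP xN]; first exact: leb_fin.
  rewrite (_ : xsection _ _ = set0) ?measure0//.
  apply/seteqP; split => // y; rewrite /xsection /= => /set_mem[[[x01 _] _] _].
  by apply: xN; exact/mem_set.
have -> : ((5 / 16)%:E = \int[leb]_(x in I01) (5 / 16 : R)%:E)%E.
  by rewrite integral_cst// [X in (_ * X)%E](leb01_I01 R) mule1.
rewrite -ge0_integralZl_EFin//; first last.
- exact/measurable_EFinP.
- by move=> x _; rewrite lee_fin sqr_ge0.
rewrite -ge0_integralD//; first last.
- by apply/measurable_EFinP; exact: measurable_funM.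
- by move=> x _; rewrite -EFinM lee_fin mulr_ge0// sqr_ge0.
apply: ge0_le_integral => //.
- by move=> x _; rewrite lee_fin.
- by apply/measurable_EFinP; exact: measurable_funTS.
- by apply/measurable_EFinP; apply: measurable_funD => //; exact: measurable_funM.
(* AM-GM: [a - 1/4 <= 1/16 + 4 (a - 1/4)^2] *)
move=> x _; rewrite -EFinM -EFinD lee_fin.
have := sqr_ge0 (a x - 4^-1 - 8^-1); lra.
Qed.

(** The part of the half square that leaves it at time [n] is carried, without change of measure,
    into the image minus the half square. *)
Lemma half_square_recurrence :
  (sq half_square <= sq P + sq (symdiff (iter n S @` half_square) half_square))%E.
Proof.
have iFn := mp_iso_iter n iF; have [FK FiK mF mFi _] := iFn.
have [-> _] : iter n S @` half_square = iter n F @` half_square /\ _ :=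
  image_iter_on_DZ n (@subIsetl _ _ _) SF.
have mH := measurable_half_square.
have mFH := measurable_image_iso iFn mH.
have mD : measurable (half_square `\` iter n F @^-1` half_square).
  by apply: measurableD => //; exact: measurable_preimage.
apply: (@le_trans _ _ (sq (P `|` (half_square `\` iter n F @^-1` half_square)))).
  rewrite le_measure ?inE//; first exact: measurableU.
  by move=> z Hz; have [] := pselect (half_square (iter n F z)); [left|right].
apply: le_trans (measureU2 _ mP mD) _; apply: leeD => //.
apply: (@le_trans _ _ (sq (iter n F @` (half_square `\` iter n F @^-1` half_square)))).
  by rewrite (measure_image_iso iFn).
rewrite le_measure ?inE//.
- exact: (measurable_image_iso iFn).
- exact: measurable_symdiff.
- by move=> _ [z [Hz nz] <-]; left; split => //; exists z.
Qed.

End correlation.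

Lemma mixing_not_recurrent (T0 : R -> R) (S : R * R -> R * R) :
  inv_mpt mZ DZ S -> strongly_mixing_ext T0 S ->
  exists n, forall k, (n <= k)%N ->
    ((8^-1)%:E <= mZ (symdiff (iter k S @` half_square) half_square))%E.
Proof.
move=> hS mixS; have [F [Fi [iF SF]]] := mp_iso_on_DZ hS.
(* The threshold is chosen so that [5/16 + 4/64 + 1/8 = 1/2], exactly the measure of the half
   square; strictness of the last term gives the contradiction. *)
have nb : nbhs (0%E : \bar R) [set u : \bar R | (u < (64^-1)%:E)%E].
  by apply: open_ereal_lt'; rewrite lte_fin invr_gt0 ltr0n.
have [n _ nP] := mixS _ _ L2ZX_half_indic L2ZX_half_indic _ nb.
exists n => k nk; rewrite leNgt; apply/negP => small.
have := half_square_recurrence k iF SF; rewrite sq01_half_square leNgt => /negP; apply.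
have Ik : (\int[leb]_(x in I01) ((fine (leb (xsection
    (half_square `&` iter k F @^-1` half_square) x)) - 4^-1) ^+ 2)%:E < (64^-1)%:E)%E.
  have := nP k nk; rewrite /=; congr (_ < _)%E.
  apply: (@eq_integral _ _ R leb) => x x01.
  rewrite (condexpX_correlation _ iF)// condexpX_half_indic.
  rewrite (_ : (fun z => (half_indic z)^*) = half_indic) ?condexpX_half_indic; last first.
    by apply/funext => z; exact: conj_half_indic.
  rewrite /csq /= !(mul0r, mulr0, subr0, addr0, expr0n) /=.
  by rewrite -invfM -natrM.
apply: (@le_lt_trans _ _ (((5 / 16)%:E + 4%:E * (64^-1)%:E) +
   sq (symdiff (iter k S @` half_square) half_square))%E).
  apply: leeD => //; apply: le_trans (correlation_bound k iF) _.
  by apply: leeD => //; apply: lee_wpmul2l; [rewrite lee_fin|exact: ltW].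
apply: (@lt_le_trans _ _ (((5 / 16)%:E + 4%:E * (64^-1)%:E) + (8^-1)%:E)%E).
  by rewrite lteD2lE.
by rewrite -!EFinM -!EFinD lee_fin; lra.
Qed.

End mixing.

Arguments half_square {R}.

(** * The category argument *)

Theorem theorem3p3 (R : realType) (T0 : R -> R) :
  inv_mpt mX I01 T0 -> periodic_map T0 -> first_category_in (GT0 T0) (ST0 T0).
Proof.
move=> hT0 perT0; split; first by move=> S [].
exists (fun n => [set S | GT0 T0 S /\ forall k, (n <= k)%N ->
  ((8^-1)%:E <= mZ (symdiff (iter k S @` half_square) half_square))%E]); split; last first.
  move=> S [GS mixS]; have [hS _] := GS.
  by have [n nP] := mixing_not_recurrent hS mixS; exists n.
move=> n U oU [T UT].
have [UG Unbhs] := oU.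
have [k1 [Es [eps [mEs eps0 U1]]]] := Unbhs _ UT.
have [S [GS Snear [N [N0 SN]]]] := periodic_extension_dense hT0 perT0 (UG _ UT) mEs eps0.
(* The time [n * N] is a multiple of the period [N], and it is at least [n] because [N] is positive,
   so it violates the condition defining the [n]-th set. *)
have SE : mZ (symdiff (iter (n * N) S @` half_square) half_square) = 0%E.
  by apply: SN; [exact: measurable_half_square|exact: subIsetl].
(* Near-return at the single time [n * N] is a weakly open condition, satisfied by the periodic [S]
   and by no member of the [n]-th set. *)
exists (U `&` [set S : R * R -> R * R |
  (mZ (symdiff (iter (n * N) S @` half_square) half_square) < (8^-1)%:E)%E]); split.
- exact: (@wopen_recurrent R T0 U half_square (8^-1) (n * N)
    (@measurable_half_square R) (@subIsetl _ _ _) oU).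
- exists S; split; first by apply: U1; split.
  by rewrite /= SE lte_fin invr_gt0 ltr0n.
- exact: subIsetl.
apply/seteqP; split => // S' [[_ /= small] [_ /(_ (n * N)%N)]].
by rewrite leNgt small leq_pmulr// => /(_ isT).
Qed.
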